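(* For every $n\ge 3$, $$\mathcal D_{n-3}^{(n)}=\frac{n!\,((n-2)!)^3}{12}\left(p_2^3-\frac{n(n-1)}{(n-2)^2}p_3^2\right).$$ In particular, if $x_1,\dots,x_n$ are real, then $$p_2^3\ge\frac{n(n-1)}{(n-2)^2}p_3^2.$$
   Context: Let $P(t)=\prod_{i=1}^n(t-x_i)$ be a monic polynomial of degree $n$ with roots $x_1,\dots,x_n$, and for $0\le k\le n-2$ let $\mathcal D_k^{(n)}=\operatorname{disc}(P^{(k)})$ with the usual leading-coefficient normalization: $\operatorname{disc}(P^{(k)})=(-1)^{m(m-1)/2}c^{-1}\operatorname{Res}(P^{(k)},P^{(k+1)})$, where $m=n-k$ and $c$ is the leading coefficient of $P^{(k)}$. Put $\bar x=\frac1n\sum_{i=1}^n x_i$, $z_i=x_i-\bar x$, and $p_r=\sum_{i=1}^n z_i^r$. *)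

(* Defs.v *)
From HB Require Import structures.
From mathcomp Require Import all_boot all_order all_algebra.

Set Implicit Arguments.
Unset Strict Implicit.
Unset Printing Implicit Defensive.

Import Order.TTheory GRing.Theory Num.Theory.
Local Open Scope ring_scope.

(* disc f = (-1)^(m(m-1)/2) c^-1 Res(f, f') with m = deg f, c = lead_coef f.
   MathComp's Sylvester matrix lists coefficients in increasing degree, so
   [resultant f g] is (-1)^(deg f * deg g) times the usual Res(f, g).  Here
   deg f * deg f' = m(m-1) is even (characteristic 0), so the two agree. *)
Definition disc (F : fieldType) (f : {poly F}) : F :=
  let m := (size f).-1 in
  (-1) ^+ (m * m.-1)./2 * (lead_coef f)^-1 * resultant f f^`().

Section Roots.

Variables (F : fieldType) (n : nat) (x : 'I_n -> F).

Definition root_poly : {poly F} := \prod_(i < n) ('X - (x i)%:P).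

(* P^`(k) is the iterated derivative, not the divided one P^`N(k). *)
Definition deriv_disc (k : nat) : F := disc root_poly^`(k).

Definition root_mean : F := (\sum_(i < n) x i) / n%:R.

Definition centered_psum (r : nat) : F := \sum_(i < n) (x i - root_mean) ^+ r.

End Roots.

(* Main.v *)
Require Import Defs.
From HB Require Import structures.
From mathcomp Require Import all_boot all_order all_algebra.
From mathcomp Require Import ring.

(* P^(n-3) is a cubic whose coefficients are factorial multiples of the
   elementary symmetric functions e_0, ..., e_3, hence polynomials in the power
   sums by Newton's identities; the formula is the explicit discriminant of a
   cubic.

   Rolle's theorem is not available for the inequality, since the real elements
   of F need not form a real closed field.  Instead assume p_3 >= 0 and let
   M = max z_i.  Then sum_i (n M z_i + p_2)^2 (M - z_i) >= 0 expands to
   n M p_3 <= p_2 (n M^2 - p_2).  Put Y = n M^2, so that p_2 <= Y <= (n-1) p_2;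
   squaring, and using that (Y - p_2)^2 / Y increases on this interval, gives
   the bound.  Replacing z by -z settles the case p_3 <= 0. *)

Set Implicit Arguments.
Unset Strict Implicit.
Unset Printing Implicit Defensive.

Import Order.TTheory GRing.Theory Num.Theory.
Local Open Scope ring_scope.

(** * The discriminant of a cubic *)

(* Laplace expansion along the first row on nat-indexed entries, so that a
   determinant of concrete size unfolds by computation. *)
Fixpoint laplace_det (R : pzRingType) (n : nat) (G : nat -> nat -> R) : R :=
  if n is m.+1 then
    foldr (fun j s => (-1) ^+ j * G 0%N j
                        * laplace_det m (fun i k => G i.+1 (bump j k)) + s)
      0 (iota 0 n)
  else 1.

Lemma det_laplace (R : comPzRingType) (n : nat) (G : nat -> nat -> R) :
  \det (\matrix_(i < n, j < n) G i j) = laplace_det n G.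
Proof.
elim: n G => [|n IHn] G; first by rewrite det_mx00.
rewrite (expand_det_row _ ord0) [RHS]/=.
transitivity (\sum_(0 <= j < n.+1)
    (-1) ^+ j * G 0%N j * laplace_det n (fun i k => G i.+1 (bump j k))).
  rewrite big_mkord; apply: eq_bigr => j _.
  rewrite mxE /cofactor mulrCA mulrA add0n -IHn.
  by congr (_ * \det _); apply/matrixP=> i k; rewrite !mxE.
by rewrite unlock /reducebig /index_iota subn0 /=.
Qed.

Lemma resultant_laplace (R : comNzRingType) (p q : {poly R}) (m n : nat) :
  size p = m.+1 -> size q = n.+1 ->
  resultant p q = laplace_det (n + m) (fun i j =>
    if (i < n)%N then p`_(j - i) *+ (i <= j)
    else q`_(j - (i - n)) *+ (i - n <= j)).
Proof.
move=> szp szq; rewrite -det_laplace.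
have -> : m = (size p).-1 by rewrite szp.
have -> : n = (size q).-1 by rewrite szq.
congr (\det _); apply/matrixP=> i j; rewrite Sylvester_mxE mxE.
by case: splitP => k ->; rewrite // addKn.
Qed.

(** As 3 is invertible, the derivative has degree exactly 2, so the Sylvester matrix is 5 by 5 and
    its determinant can be expanded explicitly. *)
Lemma disc_cubic (F : fieldType) (p : {poly F}) :
  3%:R != 0 :> F -> size p = 4%N ->
  disc p = p`_2 ^+ 2 * p`_1 ^+ 2 - 4%:R * p`_3 * p`_1 ^+ 3
           - 4%:R * p`_2 ^+ 3 * p`_0 - 27%:R * p`_3 ^+ 2 * p`_0 ^+ 2
           + 18%:R * p`_3 * p`_2 * p`_1 * p`_0.
Proof.
move=> nz3 szp.
have p3_neq0 : p`_3 != 0.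
  have -> : p`_3 = lead_coef p by rewrite lead_coefE szp.
  by rewrite lead_coef_eq0 -size_poly_eq0 szp.
(* The 5 by 5 matrix reaches index 4 in [p] and in its derivative, hence index 5 in [p]. *)
have p4 : p`_4 = 0 by rewrite nth_default ?szp.
have p5 : p`_5 = 0 by rewrite nth_default ?szp.
have szq : size p^`() = 3%N.
  apply/eqP; rewrite eqn_leq; apply/andP; split.
    by rewrite -ltnS -szp lt_size_deriv // -size_poly_gt0 szp.
  rewrite ltnNge; apply/negP => /leq_sizeP/(_ 2%N isT)/eqP.
  by rewrite coef_deriv -mulr_natr mulf_eq0 (negPf p3_neq0) (negPf nz3).
rewrite /disc (resultant_laplace szp szq) lead_coefE szp /=.
rewrite /bump /addn /subn /= !coef_deriv p4 p5 /= ?mul0rn.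
by field.
Qed.

(** * Top coefficients in terms of power sums *)

Lemma coef_mul_XsubC (R : comNzRingType) (p : {poly R}) (a : R) (j : nat) :
  (p * ('X - a%:P))`_j.+1 = p`_j - a * p`_j.+1.
Proof. by rewrite mulrBr coefB coefMX coefMC /= [_ * a]mulrC. Qed.

(* The factor 'X^3 shifts indices up by 3, so that the statement also makes
   sense for n < 3 and goes through by induction on n. *)
Lemma newton_coefs (F : fieldType) (n : nat) (x : 'I_n -> F) :
  2%:R != 0 :> F -> 3%:R != 0 :> F ->
  let p r := \sum_i x i ^+ r in
  let Q := root_poly x * 'X^3 in
  [/\ Q`_n.+3 = 1, Q`_n.+2 = - p 1%N, Q`_n.+1 = (p 1%N ^+ 2 - p 2%N) / 2%:R &
      Q`_n = - (p 1%N ^+ 3 - 3%:R * p 1%N * p 2%N + 2%:R * p 3%N) / 6%:R].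
Proof.
move=> nz2 nz3 /=.
have nz6 : 6%:R != 0 :> F by rewrite -[6%N]/(2 * 3)%N natrM mulf_neq0.
elim: n x => [|n IHn] x.
  rewrite /root_poly !big_ord0 mul1r !coefXn /=.
  by split=> //; rewrite ?expr0n /=; field.
have [] := IHn (fun i => x (widen_ord (leqnSn n) i)).
have -> : root_poly x * 'X^3 =
   (root_poly (fun i => x (widen_ord (leqnSn n) i)) * 'X^3) * ('X - (x ord_max)%:P).
  by rewrite /root_poly big_ord_recr /= mulrAC.
set Q := root_poly _ * _; rewrite !coef_mul_XsubC !big_ord_recr /=.
(* [Q] has degree n + 3, so the recursion at the leading coefficient loses its second term. *)
have -> : Q`_n.+4 = 0.
  rewrite nth_default // size_Mmonic ?monicXn ?monic_neq0 ?monic_prod_XsubC //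
    size_polyXn size_prod_XsubC.
  by rewrite -sum1_size big_const_ord iter_addn_0 mul1n addn4.
by move=> -> -> -> ->; split; field; rewrite ?nz6 ?nz2.
Qed.

(** * The inequality between power sums *)

(* The [k]-th term of the nonnegative sum of the [((n+1) z_i + z_k)^2] is
   [(n+2)^2 z_k^2]. *)
Lemma sqr_le_psum2 (F : numFieldType) (n : nat) (z : 'I_n.+2 -> F) :
  (forall i, z i \is Num.real) -> \sum_i z i = 0 ->
  forall k, n.+2%:R * z k ^+ 2 <= n.+1%:R * \sum_i z i ^+ 2.
Proof.
move=> zr z0 k; set s := \sum_i z i ^+ 2.
have sumE : \sum_i (n.+1%:R * z i + z k) ^+ 2
    = n.+1%:R ^+ 2 * s + n.+2%:R * z k ^+ 2.
  transitivity (\sum_i (n.+1%:R ^+ 2 * z i ^+ 2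
                        + (2%:R * n.+1%:R * z k * z i + z k ^+ 2))).
    by apply: eq_bigr => i _; ring.
  rewrite !big_split /= -!mulr_sumr z0 mulr0 add0r.
  by rewrite sumr_const card_ord -mulr_natl -/s; ring.
have le_k : (n.+1%:R * z k + z k) ^+ 2 <= \sum_i (n.+1%:R * z i + z k) ^+ 2.
  rewrite (bigD1 k) //= lerDl; apply: sumr_ge0 => i _.
  by rewrite real_exprn_even_ge0 // realD // realM ?realn.
have n0 : 0 < n.+1%:R :> F by rewrite ltr0n.
(* Cancelling (n+2) z_k^2 on both sides of [le_k] leaves n+1 times the claim. *)
rewrite -(ler_pM2l n0) -subr_ge0; rewrite sumE -subr_ge0 in le_k.
rewrite [X in 0 <= X](_ : _ = n.+1%:R ^+ 2 * s + n.+2%:R * z k ^+ 2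
   - (n.+1%:R * z k + z k) ^+ 2) //.
by ring.
Qed.

(** For any c, summing (z_i + c)^2 (M - z_i) >= 0 gives p_3 <= M p_2 - 2 c p_2 + n M c^2. The choice
    c = p_2 / (n M) minimizes this bound; the factor n M clears its denominator. *)
Lemma psum3_le_max (F : numFieldType) (n : nat) (z : 'I_n -> F) (M : F) :
  0 < M -> (forall i, z i \is Num.real) -> (forall i, z i <= M) ->
  \sum_i z i = 0 ->
  n%:R * M * \sum_i z i ^+ 3
    <= (\sum_i z i ^+ 2) * (n%:R * M ^+ 2 - \sum_i z i ^+ 2).
Proof.
case: n z => [|n] z M0 zr zM z0; first by rewrite !big_ord0 !mul0r.
set s := \sum_i z i ^+ 2; set t := \sum_i z i ^+ 3.
have n0 : 0 < n.+1%:R :> F by rewrite ltr0n.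
have Mr : M \is Num.real by apply: gtr0_real.
have sr : s \is Num.real by apply: rpred_sum => i _; apply: realX.
have sum_ge0 : 0 <= \sum_i (n.+1%:R * M * z i + s) ^+ 2 * (M - z i).
  apply: sumr_ge0 => i _; rewrite mulr_ge0 ?subr_ge0 //.
  by rewrite real_exprn_even_ge0 // realD // !realM ?realn.
have sumE : \sum_i (n.+1%:R * M * z i + s) ^+ 2 * (M - z i)
    = n.+1%:R * M * (s * (n.+1%:R * M ^+ 2 - s) - n.+1%:R * M * t).
  transitivity (\sum_i ((n.+1%:R ^+ 2 * M ^+ 3 - 2%:R * n.+1%:R * M * s) * z i ^+ 2
       + (- (n.+1%:R ^+ 2 * M ^+ 2) * z i ^+ 3
       + ((2%:R * n.+1%:R * M ^+ 2 * s - s ^+ 2) * z i + s ^+ 2 * M)))).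
    by apply: eq_bigr => i _; ring.
  rewrite !big_split /= -!mulr_sumr z0 -/s -/t sumr_const card_ord -mulr_natl.
  by ring.
by move: sum_ge0; rewrite sumE pmulr_rge0 ?mulr_gt0 // subr_ge0.
Qed.

Lemma psum_ineq_ge0 (F : numFieldType) (n : nat) (z : 'I_n.+2 -> F) :
  (forall i, z i \is Num.real) -> \sum_i z i = 0 -> 0 <= \sum_i z i ^+ 3 ->
  n.+2%:R * n.+1%:R * (\sum_i z i ^+ 3) ^+ 2
    <= n%:R ^+ 2 * (\sum_i z i ^+ 2) ^+ 3.
Proof.
move=> zr z0 t0.
have [k _ zk] := @real_arg_maxP F _ ord0 xpredT z isT (fun i _ => zr i).
have zM i : z i <= z k by apply: zk.
(* The maximum is at least the mean, which is 0. *)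
have M_ge0 : 0 <= z k.
  rewrite -(pmulr_rge0 (z k) (ltr0Sn F n.+1)) mulr_natl.
  rewrite -[n.+2 in X in _ <= X]card_ord.
  by rewrite -sumr_const -{1}z0; apply: ler_sum.
have s_ge0 : 0 <= \sum_i z i ^+ 2.
  by apply: sumr_ge0 => i _; rewrite real_exprn_even_ge0.
(* The main argument needs both [z k] and p_2 positive; if either vanishes, so does every [z i]. *)
have zero_case : (forall i, z i = 0) -> n.+2%:R * n.+1%:R * (\sum_i z i ^+ 3) ^+ 2
    <= n%:R ^+ 2 * (\sum_i z i ^+ 2) ^+ 3.
  move=> zi0; rewrite big1 => [|i _]; last by rewrite zi0 expr0n.
  by rewrite expr0n mulr0 mulr_ge0 ?exprn_ge0 ?ler0n.
move: M_ge0; rewrite le0r => /orP[/eqP M0|M_gt0].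
  apply: zero_case => i; apply/eqP; rewrite -oppr_eq0; apply/eqP.
  apply: (@psumr_eq0P F _ xpredT (fun j => - z j)) => // [j _|].
    by rewrite oppr_ge0 -M0.
  by rewrite sumrN z0 oppr0.
have le_t := psum3_le_max M_gt0 zr zM z0.
have le_M := sqr_le_psum2 zr z0 k.
move: s_ge0; rewrite le0r => /orP[/eqP s0|s_gt0].
  apply: zero_case => i; apply/eqP.
  suff : z i ^+ 2 == 0 by rewrite sqrf_eq0.
  apply/eqP/(@psumr_eq0P F _ xpredT (fun j => z j ^+ 2)) => // j _.
  by rewrite real_exprn_even_ge0.
set s := \sum_i z i ^+ 2 in le_t le_M s_gt0 *.
set t := \sum_i z i ^+ 3 in le_t t0 *.
set M := z k in le_t le_M M_gt0.
have n2 : 0 < n.+2%:R :> F by rewrite ltr0n.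
have n1 : 0 < n.+1%:R :> F by rewrite ltr0n.
have lhs_ge0 : 0 <= n.+2%:R * M * t by rewrite !mulr_ge0 // ltW.
have le_s : s <= n.+2%:R * M ^+ 2.
  by have := le_trans lhs_ge0 le_t; rewrite pmulr_rge0 // subr_ge0.
set Y := n.+2%:R * M ^+ 2 in le_M le_t le_s.
have Y_gt0 : 0 < Y by rewrite mulr_gt0 ?exprn_gt0.
have le_sq : (n.+2%:R * M * t) ^+ 2 <= (s * (Y - s)) ^+ 2.
  by rewrite lerXn2r ?nnegrE // (le_trans lhs_ge0).
(* (Y - s)^2 / Y increases on [s, (n+1) s] *)
have incr : n.+1%:R * (Y - s) ^+ 2 <= n%:R ^+ 2 * s * Y.
  have : 0 <= (n.+1%:R * s - Y) * (n.+1%:R * Y - s).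
    rewrite mulr_ge0 ?subr_ge0 //; apply: (le_trans le_s).
    by rewrite ler_peMl ?ler1n // ltW.
  rewrite -[n.+1%:R * (Y - s) ^+ 2 <= _]subr_ge0.
  by congr (_ <= _); ring.
(* Since (n+2) Y = ((n+2) M)^2, multiplying the goal by s Y makes its left side (n+1) s ((n+2) M
   t)^2. Then [le_sq] applies, and s^3 times [incr] finishes. *)
have sY_gt0 : s * Y > 0 by rewrite mulr_gt0.
rewrite -(ler_pM2l sY_gt0).
apply: le_trans (_ : n.+1%:R * s * (n.+2%:R * M * t) ^+ 2 <= _).
  rewrite le_eqVlt; apply/orP; left; apply/eqP.
  by rewrite /Y; ring.
apply: le_trans (_ : n.+1%:R * s * (s * (Y - s)) ^+ 2 <= _).
  by rewrite ler_pM2l ?mulr_gt0.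
have := incr; rewrite -(ler_pM2l (exprn_gt0 3 s_gt0)).
by congr (_ <= _); ring.
Qed.

Lemma psum_ineq (F : numFieldType) (n : nat) (z : 'I_n.+2 -> F) :
  (forall i, z i \is Num.real) -> \sum_i z i = 0 ->
  n.+2%:R * n.+1%:R * (\sum_i z i ^+ 3) ^+ 2
    <= n%:R ^+ 2 * (\sum_i z i ^+ 2) ^+ 3.
Proof.
move=> zr z0.
have tr : \sum_i z i ^+ 3 \is Num.real by apply: rpred_sum => i _; apply: realX.
have [t_le0|t_ge0] := real_leP tr (real0 F); last first.
  by apply: psum_ineq_ge0 => //; apply: ltW.
have sumN3 : \sum_i (- z i) ^+ 3 = - \sum_i z i ^+ 3.
  by rewrite -sumrN; apply: eq_bigr => i _; ring.
have sumN2 : \sum_i (- z i) ^+ 2 = \sum_i z i ^+ 2.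
  by apply: eq_bigr => i _; rewrite sqrrN.
have := @psum_ineq_ge0 F n (fun i => - z i).
rewrite sumN2 sumN3 sqrrN sumrN z0 oppr0 oppr_ge0.
by apply=> // i; rewrite realN.
Qed.

(** * Centred power sums in terms of raw ones *)

Lemma centered_psum1 (F : numFieldType) (n : nat) (x : 'I_n.+1 -> F) :
  \sum_i (x i - root_mean x) = 0.
Proof.
rewrite sumrB sumr_const card_ord -mulr_natl mulrC divfK ?subrr //.
by rewrite pnatr_eq0.
Qed.

(** The exponent 1 is kept so that the sums match those of [newton_coefs]. *)
Lemma centered_psum2 (F : numFieldType) (n : nat) (x : 'I_n.+1 -> F) :
  centered_psum x 2
    = \sum_i x i ^+ 2 - (\sum_i x i ^+ 1) ^+ 2 / n.+1%:R.
Proof.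
have n0 : n.+1%:R != 0 :> F by rewrite pnatr_eq0.
rewrite /centered_psum; set m := root_mean x.
transitivity (\sum_i (x i ^+ 2 + (- 2%:R * m * x i ^+ 1 + m ^+ 2))).
  by apply: eq_bigr => i _; ring.
rewrite !big_split /= -!mulr_sumr sumr_const card_ord -mulr_natl /m /root_mean.
by field; rewrite nat1r.
Qed.

Lemma centered_psum3 (F : numFieldType) (n : nat) (x : 'I_n.+1 -> F) :
  centered_psum x 3
    = \sum_i x i ^+ 3 - 3%:R * (\sum_i x i ^+ 1) * (\sum_i x i ^+ 2) / n.+1%:R
      + 2%:R * (\sum_i x i ^+ 1) ^+ 3 / n.+1%:R ^+ 2.
Proof.
have n0 : n.+1%:R != 0 :> F by rewrite pnatr_eq0.
rewrite /centered_psum; set m := root_mean x.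
transitivity (\sum_i (x i ^+ 3 + (- 3%:R * m * x i ^+ 2
                       + (3%:R * m ^+ 2 * x i ^+ 1 - m ^+ 3)))).
  by apply: eq_bigr => i _; ring.
rewrite !big_split /= -!mulr_sumr sumr_const card_ord -mulr_natl /m /root_mean.
by field; rewrite nat1r.
Qed.

Lemma natr_ffactE (F : numFieldType) (k j : nat) :
  ((k + j) ^_ k)%:R = (k + j)`!%:R / j`!%:R :> F.
Proof.
rewrite -(ffact_fact (leq_addr j k)) addKn natrM mulfK //.
by rewrite pnatr_eq0 -lt0n fact_gt0.
Qed.

(** The polynomial itself is never centred: both sides are expressed in the raw power sums and
    compared as rational functions. *)
Lemma deriv_disc_psum (F : numFieldType) (k : nat) (x : 'I_k.+3 -> F) :
  deriv_disc x k =
    k.+3`!%:R * k.+1`!%:R ^+ 3 / 12%:R *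
    (centered_psum x 2 ^+ 3
     - k.+3%:R * k.+2%:R / k.+1%:R ^+ 2 * centered_psum x 3 ^+ 2).
Proof.
have nz m : m.+1%:R != 0 :> F by rewrite pnatr_eq0.
have nzf m : m`!%:R != 0 :> F by rewrite pnatr_eq0 -lt0n fact_gt0.
have coefQ j : (root_poly x * 'X^3)`_j.+3 = (root_poly x)`_j.
  by rewrite coefMXn -[j.+3]addn3 addnK ltnNge leq_addl.
have [] := newton_coefs x (nz 1%N) (nz 2%N); rewrite /= !{}coefQ => c3 c2 c1 c0.
have coefE j : (root_poly x)^`(k)`_j
    = (root_poly x)`_(k + j) * ((k + j)`!%:R / j`!%:R).
  by rewrite coef_derivn -[LHS]mulr_natr natr_ffactE.
have size4 : size (root_poly x)^`(k) = 4%N.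
  apply/eqP; rewrite eqn_leq; apply/andP; split.
    apply/leq_sizeP => j le4j; rewrite coefE nth_default ?mul0r //.
    rewrite size_prod_XsubC -sum1_size big_const_ord iter_addn_0 mul1n.
    by rewrite -addn4 leq_add2l.
  rewrite ltnNge; apply/negP => /leq_sizeP/(_ 3%N isT)/eqP.
  by rewrite coefE addn3 c3 mul1r mulf_eq0 invr_eq0 !(negPf (nzf _)).
rewrite /deriv_disc disc_cubic // !coefE addn0 addn1 addn2 addn3 c0 c1 c2 c3.
rewrite centered_psum2 centered_psum3.
set s1 := \sum_i x i ^+ 1; set s2 := \sum_i x i ^+ 2; set s3 := \sum_i x i ^+ 3.
(* All factorials reduce to k!, after which k! and k can be treated as indeterminates; besides
   numerals, only k+1 and k+3 must be nonzero. *)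
rewrite !factS !natrM fact0.
move: (nzf k); set f := (k`!)%:R => f0.
have := (nz k, nz k.+2).
rewrite -[k.+3]addn3 -[k.+2]addn2 -[k.+1]addn1 !natrD; set K := k%:R => -[k1 k3].
by clearbody K f s1 s2 s3; field; rewrite k3 k1.
Qed.

Theorem theorem3 (F : numFieldType) (n : nat) (hn : (3 <= n)%N) (x : 'I_n -> F) :
  deriv_disc x (n - 3)%N =
    (n`!%:R * ((n - 2)`!%:R) ^+ 3) / 12%:R *
    (centered_psum x 2 ^+ 3
     - n%:R * (n%:R - 1) / (n%:R - 2%:R) ^+ 2 * centered_psum x 3 ^+ 2)
  /\
  ((forall i : 'I_n, x i \is Num.real) ->
   centered_psum x 2 ^+ 3 >=
     n%:R * (n%:R - 1) / (n%:R - 2%:R) ^+ 2 * centered_psum x 3 ^+ 2).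
Proof.
case: n hn x => [|[|[|k]]] // _ x.
rewrite (_ : k.+3%:R - 1 = k.+2%:R); last by ring.
rewrite (_ : k.+3%:R - 2%:R = k.+1%:R); last by ring.
rewrite !subSS !subn0; split; first exact: deriv_disc_psum.
move=> xr.
have mr : root_mean x \is Num.real.
  by rewrite realM ?realV ?realn //; apply: rpred_sum.
have k1 : 0 < k.+1%:R ^+ 2 :> F by rewrite exprn_gt0 ?ltr0n.
rewrite mulrAC ler_pdivrMr // [leRHS]mulrC.
apply: psum_ineq; last exact: centered_psum1.
by move=> i; rewrite realB.
Qed.
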